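(* Let $S$ be a ring and $R$ a subring of $S$ which is an integral domain contained in the center of $S$. Assume that $S$ is a free $R$-module of finite rank $n$ which is additively generated by its invertible elements. Let $\widetilde G=\operatorname{SL}(n,\overline{k})$, $G'=\operatorname{SL}(n,R)$, $T'=T\cap G'$, and assume that $T'$ is Zariski dense in $\widetilde T\cap\widetilde G$. Then $$N_{G'}(T')=\bigl(T\rtimes\operatorname{Aut}(S/R)\bigr)\cap G',$$ where $T\rtimes\operatorname{Aut}(S/R)\leqslant\operatorname{GL}(n,R)$ is the semidirect product of the normal subgroup $T$ and the group $\operatorname{Aut}(S/R)$ of ring automorphisms of $S$ that are the identity on $R$.
   Context: Rings are associative with unit, subrings are unitary. Fix an $R$-basis $\omega_1,\dots,\omega_n$ of $S$. For $\alpha\in S$ let $t(\alpha)=(t_{ij}(\alpha))\in M(n,R)$ be given by $\omega_i\alpha=\sum_{j=1}^n t_{ji}(\alpha)\omega_j$. Put $T=t(S^* )\leqslant\operatorname{GL}(n,R)$. Let $k$ be the quotient field of $R$ and $\overline{k}$ its algebraic closure. Extend $t$ by the same formula (with basis $1\otimes\omega_i$) to $\overline{k}\otimes_RS$ and put $\widetilde T=t((\overline{k}\otimes_RS)^* )\leqslant\operatorname{GL}(n,\overline{k})$. $\operatorname{Aut}(S/R)$ is regarded as a subgroup of $\operatorname{GL}(n,R)$ by sending an automorphism to its matrix (as an $R$-linear map) in the basis $\omega_1,\dots,\omega_n$ (the $i$-th column being the coordinates of the image of $\omega_i$). $N_{G'}(\cdot)$ is the normalizer in $G'$. *)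

(* Defs.v *)
From HB Require Import structures.
From mathcomp Require Import all_boot all_order all_algebra all_field.
From mathcomp Require Import mpoly.

Set Implicit Arguments.
Unset Strict Implicit.
Unset Printing Implicit Defensive.

Import GRing.Theory.
Local Open Scope ring_scope.

(* Subsets of M(n, R) are predicates 'M[R]_n -> Prop: over an infinite ring
   they are neither finite nor decidable, so {set _} and {group _} do not
   apply. *)

Definition additively_generated (V : zmodType) (X : V -> Prop) : Prop :=
  forall P : V -> Prop,
    P 0 -> (forall x y, P x -> P y -> P (x - y)) ->
    (forall x, X x -> P x) -> forall v, P v.

Section FreeAlgebra.
Variables (R : comUnitRingType) (n : nat).

Definition is_basis (V : lmodType R) (w : 'I_n -> V) : Prop :=
  forall v : V, exists! c : 'rV[R]_n, v = \sum_i c 0 i *: w i.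

(* Column i of M holds the coordinates of f (w i). *)
Definition is_matrix_of (V : lmodType R) (w : 'I_n -> V) (f : V -> V)
    (M : 'M[R]_n) : Prop :=
  forall i, f (w i) = \sum_j M j i *: w j.

Variables (A : unitAlgType R) (w : 'I_n -> A).

(* t(A^* ), where t(a) is the matrix of right multiplication by a. *)
Definition unit_matrices (M : 'M[R]_n) : Prop :=
  exists2 a : A, a \is a GRing.unit & is_matrix_of w (fun x => x * a) M.

(* Aut(A/R), acting on coordinate columns. *)
Definition aut_matrices (M : 'M[R]_n) : Prop :=
  exists f : {rmorphism A -> A},
    [/\ bijective f, forall r : R, f r%:A = r%:A & is_matrix_of w f M].

End FreeAlgebra.

Section LinearGroups.
Variables (R : comUnitRingType) (n : nat).
Implicit Types (H N A G : 'M[R]_n -> Prop) (g : 'M[R]_n).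

Definition special_linear g : Prop := \det g = 1.

Definition is_subgroup_GL H : Prop :=
  [/\ forall x, H x -> x \in unitmx,
      H 1%:M,
      forall x y, H x -> H y -> H (x *m y)
    & forall x, H x -> H (invmx x)].

(* g belongs to G and g H g^-1 = H. *)
Definition normalizer G H g : Prop :=
  G g /\ forall y, H y <-> exists2 x, H x & y = g *m x *m invmx g.

Definition product_set N A g : Prop :=
  exists x a, [/\ N x, A a & g = x *m a].

(* [product_set N A] is then the internal semidirect product of its normal
   subgroup N and A. *)
Definition is_semidirect N A : Prop :=
  [/\ is_subgroup_GL N,
      is_subgroup_GL A,
      forall x a, N x -> A a -> N (a *m x *m invmx a)
    & forall x, N x -> A x -> x = 1%:M].

End LinearGroups.

Section Zariski.
Variables (K : fieldType) (n : nat).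
Implicit Types (X Y Z : 'M[K]_n -> Prop).

Definition zero_locus (P : {mpoly K[n * n]} -> Prop) (M : 'M[K]_n) : Prop :=
  forall p, P p -> p.@[fun i => mxvec M 0 i] = 0.

Definition zariski_closed Z : Prop :=
  exists P, forall M, Z M <-> zero_locus P M.

Definition zariski_dense X Y : Prop :=
  (forall M, X M -> Y M) /\
  forall Z, zariski_closed Z -> (forall M, X M -> Z M) -> forall M, Y M -> Z M.

End Zariski.

(* K together with iota is an algebraic closure of F. *)
Definition is_algebraic_closure (F : fieldType) (K : closedFieldType)
    (iota : {rmorphism F -> K}) : Prop :=
  forall x : K, algebraicOver iota x.

Section TensorAlgebra.
Variables (R : comUnitRingType) (K : fieldType) (j : R -> K).
Variable S : unitAlgType R.

Definition is_balanced (V : zmodType) (f : K -> S -> V) : Prop :=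
  [/\ forall c d s, f (c + d) s = f c s + f d s,
      forall c s u, f c (s + u) = f c s + f c u
    & forall c r s, f (c * j r) s = f c (r *: s)].

(* The K-algebra A, with tens c s standing for c (x) s, is the tensor product
   of K (an R-algebra through j) and S over R: the first two fields are the
   universal property of the additive group, the others give the product, the
   unit and the scalars. *)
Record is_tensor_algebra (A : unitAlgType K) (tens : K -> S -> A) : Prop := {
  tens_balanced : is_balanced tens;
  tens_universal : forall (V : zmodType) (f : K -> S -> V), is_balanced f ->
    (exists g : {additive A -> V}, forall c s, g (tens c s) = f c s) /\
    (forall g h : {additive A -> V},
       (forall c s, g (tens c s) = h (tens c s)) -> g =1 h);
  tens_mul : forall c d s u, tens c s * tens d u = tens (c * d) (s * u);
  tens_one : tens 1 1 = 1;
  tens_scale : forall c d s, c *: tens d s = tens (c * d) s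
}.

End TensorAlgebra.

Definition image_mx (R K : Type) (n : nat) (j : R -> K)
    (X : 'M[R]_n -> Prop) (M : 'M[K]_n) : Prop :=
  exists2 x, X x & M = map_mx j x.

(* Main.v *)
Require Import Defs.
From HB Require Import structures.
From mathcomp Require Import all_boot all_order all_algebra all_field.
From mathcomp Require Import mpoly.

Set Implicit Arguments.
Unset Strict Implicit.
Unset Printing Implicit Defensive.

Import GRing.Theory.
Local Open Scope ring_scope.

(** Let g in SL(n, R) normalize T'.  The point is that the whole ring t(S) of
   right multiplications, and not only T', is then normalized by g.  An
   endomorphism of the module S is a right multiplication as soon as it commutes
   with the left multiplications by the w i ([right_mul_of_commutant]): if N does,
   then N (w i) = w i * N 1.  Hence the condition that g M g^-1 be a right
   multiplication is a system of homogeneous linear equations in the entries of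
   M, which defines a Zariski closed set.  It holds on T', so by density it holds
   on all matrices of determinant 1 in Ttilde.  A unit a of S gives such a
   matrix once t(a) is multiplied by an n-th root of its inverse determinant in
   the algebraically closed field K, and homogeneous equations do not see this
   scalar.  So g t(a) g^-1 commutes with the left multiplications, over K and,
   R -> K being injective, also over R: it is in t(S)
   ([dense_conj_unit_matrix]).  As S is additively generated by its units,
   g t(S) g^-1 is contained in t(S) ([dense_conj_mul_matrix]), and the same holds
   for g^-1.

   The rest is ring theory ([additive_bij_normalizing_mulr]).  If G is the
   endomorphism with matrix g, then G (x * a) = G x * phi a for some phi a; with
   u = G 1 this reads G a = u * phi a.  As phi is an automorphism of S, u is a
   unit and G a = (u * phi a * u^-1) * u: G is an automorphism followed by the
   right multiplication by u, which means that g is in the product of T and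
   Aut(S/R).

   Conversely an automorphism f conjugates the right multiplication by s to that
   by f s, so T is normal in the product, and conjugation preserves
   determinants. *)

(** * Bijections normalizing the right multiplications of a ring *)

Lemma rmorphism_of (A B : nzRingType) (f : A -> B) :
    {morph f : x y / x - y} -> {morph f : x y / x * y} -> f 1 = 1 ->
  exists F : {rmorphism A -> B}, F =1 f.
Proof.
move=> fB fM f1.
pose addM := GRing.isZmodMorphism.Build A B f fB.
pose mulM := GRing.isMonoidMorphism.Build A B f (f1, fM).
by exists (HB.pack f addM mulM : {rmorphism A -> B}).
Qed.

(** With u = G 1, the element s attached to a in G (x * a) = G x * s satisfies
   G a = u * s, so that the automorphism to find can only be x |-> G x / u.
   Multiplicativity is then immediate; the work is in the invertibility of u:
   the hypothesis on H provides a preimage of u under a |-> s, and this turns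
   the right inverse of u into a two-sided one. *)
Lemma additive_bij_normalizing_mulr (A : unitRingType) (G H : A -> A) :
    {morph G : x y / x - y} -> cancel G H -> cancel H G ->
    (forall a, exists s, forall x, G (H x * a) = x * s) ->
    (forall a, exists s, forall x, H (G x * a) = x * s) ->
  exists u, exists2 f : {rmorphism A -> A},
    u \is a GRing.unit & bijective f /\ forall x, G x = f x * u.
Proof.
move=> GB GK HK normG normH; pose u := G 1.
have normG1 a : exists s, forall x, G (x * a) = G x * s.
  by have [s Gs] := normG a; exists s => x; rewrite -Gs GK.
have [s Gs] := normG1 (H 1).
have us : u * s = 1 by rewrite -Gs mul1r HK.
(* Writing s = phi (H 1), the element s' has phi s' = u and H 1 * s' = 1, so
   that applying phi to the last equation gives s * u = 1; below, b is phi s'. *)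
have su : s * u = 1.
  have [s' Hs'] := normH u.
  have Hs1 : H 1 * s' = 1 by rewrite -Hs' HK mul1r GK.
  have [b Gb] := normG1 s'.
  have bE : b = u.
    have: G (H 1 * s') = 1 * b by rewrite Gb HK.
    by rewrite Hs1 mul1r.
  by have := Gb (H 1 * H 1); rewrite -mulrA Hs1 mulr1 Gs HK mul1r bE => <-.
have uU : u \is a GRing.unit by apply/unitrP; exists s.
have GM x y : G (x * y) = G x / u * G y.
  have [c Gc] := normG1 y.
  by rewrite -[y in RHS]mul1r !Gc -/u mulrA divrK.
pose f x := G x / u.
have fB : {morph f : x y / x - y} by move=> x y; rewrite /f GB mulrBl.
have fM : {morph f : x y / x * y} by move=> x y; rewrite /f GM !mulrA.
have [|F FE] := rmorphism_of fB fM; first by rewrite /f divrr.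
exists u; exists F => //; split=> [|x]; last by rewrite FE divrK.
exists (fun y => H (y * u)) => x; first by rewrite FE divrK ?GK.
by rewrite FE /f HK mulrK.
Qed.

Lemma linear_comp (R : pzRingType) (U V W : lmodType R) (f : V -> W) (h : U -> V) :
  linear f -> linear h -> linear (f \o h).
Proof. by move=> linf linh c x y; rewrite /= linh linf. Qed.

(** * Matrices of linear maps in a basis *)

Section BasisMatrices.
Variables (R : comUnitRingType) (n : nat) (V : lmodType R) (w : 'I_n -> V).

Lemma linear_sumZ (U : lmodType R) (f : V -> U) (c : 'I_n -> R) (v : 'I_n -> V) :
  linear f -> f (\sum_i c i *: v i) = \sum_i c i *: f (v i).
Proof.
move=> linf; pose F : {linear V -> U} := HB.pack f (GRing.isLinear.Build _ _ _ _ f linf).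
by rewrite -[f]/(F : V -> U) linear_sum; apply: eq_bigr => i _; rewrite linearZ.
Qed.

Lemma matrix_of_id : is_matrix_of w id 1%:M.
Proof.
move=> i; rewrite (bigD1 i) //= mxE eqxx scale1r big1 ?addr0 // => k ki.
by rewrite mxE (negPf ki) scale0r.
Qed.

Lemma matrix_of_comp f h M N : linear f ->
  is_matrix_of w f M -> is_matrix_of w h N -> is_matrix_of w (f \o h) (M *m N).
Proof.
move=> linf fM hN i; rewrite /= hN linear_sumZ //.
under [LHS]eq_bigr do rewrite fM scaler_sumr.
rewrite exchange_big; apply: eq_bigr => k _; rewrite mxE scaler_suml.
by apply: eq_bigr => l _; rewrite scalerA mulrC.
Qed.

Lemma eq_matrix_of f h M : f =1 h -> is_matrix_of w f M -> is_matrix_of w h M.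
Proof. by move=> fh fM i; rewrite -fh. Qed.

Hypothesis w_basis : is_basis w.

Lemma basis_coord v : exists c : 'rV[R]_n, v == \sum_i c 0 i *: w i.
Proof. by have [c [-> _]] := w_basis v; exists c. Qed.

Lemma basis_inj (c d : 'rV[R]_n) :
  \sum_i c 0 i *: w i = \sum_i d 0 i *: w i -> c = d.
Proof.
have [e [_ eU]] := w_basis (\sum_i c 0 i *: w i).
by move=> cd; rewrite -(eU c) // -(eU d).
Qed.

Lemma basis_universal (U : lmodType R) (u : 'I_n -> U) :
  exists F : {linear V -> U}, forall i, F (w i) = u i.
Proof.
pose co v := xchoose (basis_coord v).
have coP v : v = \sum_i co v 0 i *: w i by apply/eqP/(xchooseP (basis_coord v)).
have co_lin a x y : co (a *: x + y) = a *: co x + co y.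
  apply: basis_inj; rewrite -coP [in LHS](coP x) [in LHS](coP y) scaler_sumr.
  by rewrite -big_split; apply: eq_bigr => i _; rewrite !mxE scalerA scalerDl.
pose f v := \sum_i co v 0 i *: u i.
have linf : linear f.
  move=> a x y; rewrite /f co_lin scaler_sumr -big_split.
  by apply: eq_bigr => i _; rewrite !mxE scalerA scalerDl.
exists (HB.pack f (GRing.isLinear.Build _ _ _ _ f linf) : {linear V -> U}) => i.
rewrite /= /f (_ : co (w i) = delta_mx 0 i).
  rewrite (bigD1 i) //= mxE !eqxx scale1r big1 ?addr0 // => k ki.
  by rewrite mxE (negPf ki) andbF scale0r.
apply: basis_inj; rewrite -coP (bigD1 i) //= mxE !eqxx scale1r big1 ?addr0 // => k ki.
by rewrite mxE (negPf ki) andbF scale0r.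
Qed.

Lemma matrix_of_ex f : exists M, is_matrix_of w f M.
Proof.
exists (\matrix_(k, i) xchoose (basis_coord (f (w i))) 0 k) => i.
rewrite [LHS](eqP (xchooseP (basis_coord (f (w i))))).
by apply: eq_bigr => k _; rewrite mxE.
Qed.

Lemma linear_of_matrix M : exists F : {linear V -> V}, is_matrix_of w F M.
Proof. exact: basis_universal. Qed.

Lemma matrix_of_inj f M N : is_matrix_of w f M -> is_matrix_of w f N -> M = N.
Proof.
move=> fM fN; apply/trmx_inj/row_matrixP => i.
have rowE P : \sum_k row i P^T 0 k *: w k = \sum_k P k i *: w k.
  by apply: eq_bigr => k _; rewrite !mxE.
by apply: basis_inj; rewrite !rowE -fM -fN.
Qed.

Lemma linear_basis_eq (U : lmodType R) (f h : V -> U) : linear f -> linear h ->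
  (forall i, f (w i) = h (w i)) -> f =1 h.
Proof.
move=> linf linh fh v; have [c /eqP->] := basis_coord v.
by rewrite !linear_sumZ //; apply: eq_bigr => i _; rewrite fh.
Qed.

Lemma matrix_of_eq1 f h M : linear f -> linear h ->
  is_matrix_of w f M -> is_matrix_of w h M -> f =1 h.
Proof. by move=> linf linh fM hM; apply: linear_basis_eq => // i; rewrite fM hM. Qed.

Lemma matrix_of_cancel f h M N : linear f -> cancel h f ->
  is_matrix_of w f M -> is_matrix_of w h N -> M \in unitmx /\ N = invmx M.
Proof.
move=> linf hK fM hN.
have MN : M *m N = 1%:M.
  apply: matrix_of_inj matrix_of_id.
  exact: eq_matrix_of hK (matrix_of_comp linf fM hN).
have [Mu _] := mulmx1_unit MN; split=> //.
by rewrite -[N]mul1mx -(mulVmx Mu) -mulmxA MN mulmx1.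
Qed.

End BasisMatrices.

(** * The groups of units and of automorphisms of a free algebra *)

Section Algebra.
Variables (R : comUnitRingType) (n : nat) (A : unitAlgType R) (w : 'I_n -> A).
Hypothesis w_basis : is_basis w.

Lemma mulr_linear (a : A) : linear (fun x => x * a).
Proof. by move=> c x y; rewrite mulrDl scalerAl. Qed.

Lemma mull_linear (a : A) : linear (fun x => a * x).
Proof. by move=> c x y; rewrite mulrDr scalerAr. Qed.

Lemma scalar_fixing_linear (f : {rmorphism A -> A}) :
  (forall r : R, f r%:A = r%:A) -> linear f.
Proof.
by move=> fR c x y; rewrite rmorphD -[c *: x]mulr_algl rmorphM fR mulr_algl.
Qed.

(** The commutant of the left multiplications consists of right
   multiplications: N (w i * 1) = w i * N 1.  Being a right multiplication thus
   becomes a linear condition on a matrix, with coefficients in R, which can be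
   tested after extension of scalars. *)
Lemma right_mul_of_commutant (N : 'M[R]_n) :
    (forall i L, is_matrix_of w (fun x => w i * x) L -> N *m L = L *m N) ->
  exists s, is_matrix_of w (fun x => x * s) N.
Proof.
move=> NL; have [F FN] := linear_of_matrix w_basis N.
exists (F 1) => i; rewrite -FN.
have [L wL] := matrix_of_ex w_basis (fun x => w i * x).
have wFN := matrix_of_comp (mull_linear (w i)) wL FN.
have FwL := matrix_of_comp (linearP F) FN wL.
rewrite (NL i L wL) in FwL.
have linFw := linear_comp (linearP F) (mull_linear (w i)).
have linwF := linear_comp (mull_linear (w i)) (linearP F).
by have := matrix_of_eq1 w_basis linFw linwF FwL wFN 1; rewrite /= mulr1.
Qed.

Lemma unit_matrices_subgroup : is_subgroup_GL (unit_matrices w).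
Proof.
have inv a M : a \is a GRing.unit -> is_matrix_of w (fun x => x * a) M ->
    M \in unitmx /\ is_matrix_of w (fun x => x / a) (invmx M).
  move=> aU aM; have [N aN] := matrix_of_ex w_basis (fun x => x / a).
  by have [Mu <-] := matrix_of_cancel w_basis (mulr_linear a) (divrK aU) aM aN.
split.
- by move=> M [a aU /(inv a M aU)[]].
- exists 1; first exact: unitr1.
  by apply: eq_matrix_of (matrix_of_id w) => x; rewrite mulr1.
- move=> M N [a aU aM] [b bU bN]; exists (b * a); first by rewrite unitrMl.
  apply: eq_matrix_of (matrix_of_comp (mulr_linear a) aM bN) => x /=.
  by rewrite mulrA.
by move=> M [a aU /(inv a M aU)[_ aM]]; exists a^-1; rewrite ?unitrV.
Qed.

Lemma aut_matrices_inv M : aut_matrices w M ->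
  M \in unitmx /\ aut_matrices w (invmx M).
Proof.
case=> f [[h fK hK] fR fM]; have linf := scalar_fixing_linear fR.
have [N hN] := matrix_of_ex w_basis h.
have [Mu <-] := matrix_of_cancel w_basis linf hK fM hN; split=> //.
have injf := can_inj fK.
have hB : {morph h : x y / x - y}.
  by move=> x y; apply: injf; rewrite rmorphB !hK.
have hM : {morph h : x y / x * y}.
  by move=> x y; apply: injf; rewrite rmorphM !hK.
have [|F FE] := rmorphism_of hB hM; first by apply: injf; rewrite hK rmorph1.
exists F; split.
- by exists f => x; rewrite FE ?hK ?fK.
- by move=> r; rewrite FE -[in LHS](fR r) fK.
by apply: eq_matrix_of hN => x; rewrite FE.
Qed.

Lemma aut_matrices_subgroup : is_subgroup_GL (aut_matrices w).
Proof.
split.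
- by move=> M /aut_matrices_inv[].
- exists idfun; split=> //; first by exists id.
  exact: matrix_of_id.
- move=> M N [f [bijf fR fM]] [h [bijh hR hN]].
  exists (f \o h : {rmorphism A -> A}); split.
  + exact: bij_comp.
  + by move=> r; rewrite /= hR fR.
  by apply: matrix_of_comp => //; apply: scalar_fixing_linear.
by move=> M /aut_matrices_inv[].
Qed.

(** f (f^-1 y * s) = y * f s. *)
Lemma aut_conj_unit_matrices x a :
  unit_matrices w x -> aut_matrices w a -> unit_matrices w (a *m x *m invmx a).
Proof.
case=> s sU sx [f [[h fK hK] fR fa]]; have linf := scalar_fixing_linear fR.
have [b hb] := matrix_of_ex w_basis h.
have [au bE] := matrix_of_cancel w_basis linf hK fa hb; rewrite -bE.
exists (f s); first exact: rmorph_unit.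
have linfs := linear_comp linf (mulr_linear s).
have fsh := matrix_of_comp linfs (matrix_of_comp linf fa sx) hb.
by apply: eq_matrix_of fsh => y; rewrite /= rmorphM hK.
Qed.

(** The intersection is trivial because an automorphism fixes 1, while the right
   multiplication by s sends 1 to s. *)
Lemma unit_aut_semidirect : is_semidirect (unit_matrices w) (aut_matrices w).
Proof.
split; [exact: unit_matrices_subgroup | exact: aut_matrices_subgroup
       | exact: aut_conj_unit_matrices | ].
move=> x [s _ sx] [f [_ fR fx]].
have fs := matrix_of_eq1 w_basis (scalar_fixing_linear fR) (mulr_linear s) fx sx.
apply: (matrix_of_inj w_basis sx); apply: eq_matrix_of (matrix_of_id w) => y.
by move: (fs 1); rewrite rmorph1 mul1r => <-; rewrite mulr1.
Qed.

(** Matrix form of [additive_bij_normalizing_mulr].  The automorphism obtained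
   there fixes R because G is R-linear: G r = r * G 1 = r * u. *)
Lemma normalizing_mulr_product g : g \in unitmx ->
    (forall a M, is_matrix_of w (fun x => x * a) M -> exists s,
       is_matrix_of w (fun x => x * s) (g *m M *m invmx g)) ->
    (forall a M, is_matrix_of w (fun x => x * a) M -> exists s,
       is_matrix_of w (fun x => x * s) (invmx g *m M *m g)) ->
  product_set (unit_matrices w) (aut_matrices w) g.
Proof.
move=> gU normg normg'.
have [G Gg] := linear_of_matrix w_basis g.
have [H Hg] := linear_of_matrix w_basis (invmx g).
have comp1 (E F : {linear A -> A}) M N : is_matrix_of w E M ->
    is_matrix_of w F N -> N *m M = 1%:M -> cancel E F.
  move=> EM FN NM x; have FE := matrix_of_comp (linearP F) FN EM.
  have linFE := linear_comp (linearP F) (linearP E).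
  rewrite NM in FE; have linid : linear (@id A) by [].
  exact: (matrix_of_eq1 w_basis linFE linid FE (matrix_of_id w)).
have conj (E F : {linear A -> A}) M N : is_matrix_of w E M ->
    is_matrix_of w F N ->
    (forall a P, is_matrix_of w (fun x => x * a) P -> exists s,
       is_matrix_of w (fun x => x * s) (M *m P *m N)) ->
    forall a, exists s, forall x, E (F x * a) = x * s.
  move=> EM FN norm a; have [P aP] := matrix_of_ex w_basis (fun x => x * a).
  have [s sP] := norm a P aP; exists s => x.
  have linEa := linear_comp (linearP E) (mulr_linear a).
  have EaF := matrix_of_comp linEa (matrix_of_comp (linearP E) EM aP) FN.
  have linEaF := linear_comp linEa (linearP F).
  exact: (matrix_of_eq1 w_basis linEaF (mulr_linear s) EaF sP).
have GK := comp1 _ _ _ _ Gg Hg (mulVmx gU).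
have HK := comp1 _ _ _ _ Hg Gg (mulmxV gU).
have [u [f uU [bijf GE]]] := additive_bij_normalizing_mulr (linearB G) GK HK
  (conj _ _ _ _ Gg Hg normg) (conj _ _ _ _ Hg Gg normg').
have fR r : f r%:A = r%:A.
  have G1 : G 1 = u by rewrite GE rmorph1 mul1r.
  by apply: (mulIr uU); rewrite -GE linearZ G1 mulr_algl.
have [M uM] := matrix_of_ex w_basis (fun x => x * u).
have [N fN] := matrix_of_ex w_basis f.
exists M, N; split; [by exists u | by exists f | ].
apply: (matrix_of_inj w_basis Gg).
apply: eq_matrix_of (matrix_of_comp (mulr_linear u) uM fN) => x.
by rewrite GE.
Qed.

End Algebra.

(** * Linear conditions and Zariski density *)

Section ZariskiLinear.
Variables (K : fieldType) (n : nat).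

Lemma zariski_closed_linear m (F : {linear 'M[K]_n -> 'M[K]_m}) :
  zariski_closed (fun M => F M = 0).
Proof.
pose q i : {mpoly K[n * n]} := \sum_k lin_mx F k i *: 'X_k.
have qE M i : (q i).@[fun k => mxvec M 0 k] = mxvec (F M) 0 i.
  rewrite -mul_vec_lin mxE raddf_sum; apply: eq_bigr => k _.
  by rewrite /= mevalZ mevalXU mulrC.
exists (fun p => exists i, p = q i) => M; split=> [FM0 p [i ->] | FM0].
  by rewrite qE FM0 linear0 mxE.
apply: (can_inj mxvecK); rewrite linear0; apply/rowP => i.
by rewrite -qE FM0 ?mxE //; exists i.
Qed.

Lemma zariski_dense_commute (X Y : 'M[K]_n -> Prop) (B C L : 'M[K]_n) :
    zariski_dense X Y ->
    (forall M, X M -> B *m M *m C *m L = L *m (B *m M *m C)) ->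
  forall M, Y M -> B *m M *m C *m L = L *m (B *m M *m C).
Proof.
case=> _ dense XL M YM; pose F N := B *m N *m C *m L - L *m (B *m N *m C).
have linF : linear F.
  move=> c N N'; rewrite /F !(mulmxDr, mulmxDl) -!(scalemxAr, scalemxAl).
  by rewrite opprD addrACA -scalerBr.
apply/eqP; rewrite -subr_eq0; apply/eqP.
pose F' : {linear _ -> _} := HB.pack F (GRing.isLinear.Build _ _ _ _ F linF).
apply: (dense _ (zariski_closed_linear F')) => // N /XL /eqP.
by rewrite -subr_eq0 => /eqP.
Qed.

End ZariskiLinear.

(** It is for this root extraction that the base field has to be enlarged to an
   algebraically closed one. *)
Lemma det1_rescaling (K : closedFieldType) n (M : 'M[K]_n) :
  (0 < n)%N -> M \in unitmx -> exists2 c, c != 0 & \det (c *: M) = 1.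
Proof.
move=> n_gt0; rewrite unitmxE unitfE => detM.
have [c cn] := solve_monicpoly (fun i => if i == 0 then (\det M)^-1 else 0) n_gt0.
move: cn; case: n n_gt0 M detM => // n _ M detM.
rewrite big_ord_recl big1 => [|i _]; last by rewrite mul0r.
rewrite /= addr0 mulr1 => cn.
have c1 : \det (c *: M) = 1 by rewrite detZ cn mulVf.
exists c => //; apply: contra_eq_neq c1 => ->.
by rewrite scale0r det0 // eq_sym oner_neq0.
Qed.

(** * Conjugates of right multiplications, by density *)

Section DenseNormalizer.
Variables (R : comUnitRingType) (n : nat) (S : unitAlgType R) (w : 'I_n -> S).
Variables (K : closedFieldType) (j : {rmorphism R -> K}).
Variables (KS : unitAlgType K) (tens : K -> S -> KS).
Hypotheses (w_basis : is_basis w) (j_inj : injective j).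
Hypothesis KS_tensor : is_tensor_algebra j tens.

(** The matrix c * t(a) is t(c (x) a), with c (x) a invertible. *)
Lemma extended_unit_matrices (a : S) (M : 'M[R]_n) (c : K) :
    a \is a GRing.unit -> is_matrix_of w (fun x => x * a) M -> c != 0 ->
  unit_matrices (fun i => tens 1 (w i)) (c *: map_mx j M).
Proof.
move=> aU aM c0; case: KS_tensor => [[_ tensD tensZ] _ tensM tens1 tensS].
have tens_sum k : tens 1 (w k * a) = \sum_l j (M l k) *: tens 1 (w l).
  rewrite aM.
  have tens0 : tens 1 0 = 0 by apply: (addIr (tens 1 0)); rewrite -tensD !add0r.
  rewrite (big_morph _ (tensD 1) tens0).
  by apply: eq_bigr => l _; rewrite -tensZ mul1r tensS mulr1.
exists (tens c a) => [|k].
  apply/unitrP; exists (tens c^-1 a^-1).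
  by rewrite !tensM mulVf // mulfV // mulVr // divrr.
rewrite tensM mulrC -[tens _ _]/(tens (c * 1) _) -tensS tens_sum scaler_sumr.
by apply: eq_bigr => l _; rewrite !mxE scalerA.
Qed.

Let T' (M : 'M[R]_n) := unit_matrices w M /\ special_linear M.

(** By density the equations of [right_mul_of_commutant] for g M g^-1 pass from
   T' to the determinant 1 multiple c * t(a) of t(a); they are homogeneous, so
   c cancels, and the result comes back from K to R. *)
Lemma dense_conj_unit_matrix g a M :
    zariski_dense (image_mx j T') (fun M =>
      unit_matrices (fun i => tens 1 (w i)) M /\ special_linear M) ->
    (forall x, T' x -> T' (g *m x *m invmx g)) ->
    a \is a GRing.unit -> is_matrix_of w (fun x => x * a) M ->
  exists s, is_matrix_of w (fun x => x * s) (g *m M *m invmx g).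
Proof.
move=> dense normT' aU aM; apply: right_mul_of_commutant => // i L wL.
have n_gt0 : (0 < n)%N := leq_ltn_trans (leq0n i) (ltn_ord i).
have MU : M \in unitmx.
  by have [TU _ _ _] := unit_matrices_subgroup w_basis; apply: TU; exists a.
have jMU : map_mx j M \in unitmx by rewrite unitmxE det_map_mx rmorph_unit.
have [c c0 detc] := det1_rescaling n_gt0 jMU.
have commT' N : image_mx j T' N ->
    map_mx j g *m N *m map_mx j (invmx g) *m map_mx j L
      = map_mx j L *m (map_mx j g *m N *m map_mx j (invmx g)).
  case=> x /normT'[[s _ sx] _] ->; rewrite -!map_mxM; congr map_mx.
  apply: (matrix_of_inj w_basis
    (matrix_of_comp (mulr_linear s) sx wL)).
  apply: eq_matrix_of (matrix_of_comp (mull_linear (w i)) wL sx) => y /=.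
  by rewrite mulrA.
have := zariski_dense_commute dense commT' (conj (extended_unit_matrices aU aM c0) detc).
rewrite -!(scalemxAr, scalemxAl) -!map_mxM => /(scalerI c0).
move=> /matrixP jE; apply/matrixP => k l; apply: j_inj.
by have := jE k l; rewrite [LHS]mxE [RHS]mxE.
Qed.

Lemma dense_conj_mul_matrix g :
    additively_generated (fun x : S => x \is a GRing.unit) ->
    zariski_dense (image_mx j T') (fun M =>
      unit_matrices (fun i => tens 1 (w i)) M /\ special_linear M) ->
    (forall x, T' x -> T' (g *m x *m invmx g)) ->
  forall a M, is_matrix_of w (fun x => x * a) M ->
    exists s, is_matrix_of w (fun x => x * s) (g *m M *m invmx g).
Proof.
move=> S_gen dense normT'; apply: S_gen => [M aM | a b IHa IHb M abM | a aU M].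
- have M0 : M = 0.
    apply: (matrix_of_inj w_basis aM) => i.
    by rewrite mulr0 big1 // => k _; rewrite mxE scale0r.
  by exists 0; rewrite M0 mulmx0 mul0mx -M0.
- have [M1 aM1] := matrix_of_ex w_basis (fun x => x * a).
  have [M2 bM2] := matrix_of_ex w_basis (fun x => x * b).
  have sub x y N1 N2 : is_matrix_of w (fun z => z * x) N1 ->
      is_matrix_of w (fun z => z * y) N2 ->
      is_matrix_of w (fun z => z * (x - y)) (N1 - N2).
    move=> xN yN i; rewrite mulrBr xN yN -sumrB.
    by apply: eq_bigr => k _; rewrite !mxE scalerBl.
  have -> := matrix_of_inj w_basis abM (sub _ _ _ _ aM1 bM2).
  have [s sM] := IHa _ aM1; have [t tM] := IHb _ bM2.
  by exists (s - t); rewrite mulmxBr mulmxBl; apply: sub.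
exact: dense_conj_unit_matrix.
Qed.

End DenseNormalizer.

(** * The normalizer *)

Lemma semidirect_product_normalizes (R : comUnitRingType) n
    (N A : 'M[R]_n -> Prop) g :
    is_semidirect N A -> product_set N A g ->
  [/\ g \in unitmx, forall x, N x -> N (g *m x *m invmx g)
    & forall x, N x -> N (invmx g *m x *m g)].
Proof.
case=> [[NU _ NM NV] [AU _ _ AV] NA _] [x [a [Nx Aa ->]]].
have [xU aU] := (NU x Nx, AU a Aa).
have xaU : x *m a \in unitmx by rewrite unitmx_mul xU.
have -> : invmx (x *m a) = invmx a *m invmx x.
  apply: (can_inj (mulKmx xaU)).
  by rewrite mulmxV // -mulmxA mulKVmx // mulmxV.
split=> // y Ny.
  have -> : x *m a *m y *m (invmx a *m invmx x)
      = x *m (a *m y *m invmx a) *m invmx x by rewrite !mulmxA.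
  apply: (NM _ _ _ (NV _ Nx)); apply: NM => //; exact: NA.
have -> : invmx a *m invmx x *m y *m (x *m a)
    = invmx a *m (invmx x *m y *m x) *m invmx (invmx a).
  by rewrite invmxK !mulmxA.
apply: NA; last exact: AV.
by apply: (NM _ _ _ Nx); apply: (NM _ _ _ Ny); apply: NV.
Qed.

Theorem theorem7p2
  (R : idomainType) (S : unitAlgType R) (R_subring : injective (GRing.in_alg S))
  (n : nat) (w : 'I_n -> S) (w_basis : is_basis w)
  (S_gen : additively_generated (fun x : S => x \is a GRing.unit))
  (K : closedFieldType) (iota : {rmorphism {fraction R} -> K})
  (K_closure : is_algebraic_closure iota)
  (j := fun r : R => iota (FracField.tofrac r))
  (KS : unitAlgType K) (tens : K -> S -> KS)
  (KS_tensor : is_tensor_algebra j tens)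
  (T := unit_matrices w)
  (T' := fun M => T M /\ special_linear M)
  (Ttilde := unit_matrices (fun i => tens 1 (w i)))
  (T'_dense : zariski_dense (image_mx j T')
                (fun M => Ttilde M /\ special_linear M)) :
  is_semidirect T (aut_matrices w) /\
  forall g : 'M[R]_n,
    normalizer (@special_linear R n) T' g <->
    product_set T (aut_matrices w) g /\ special_linear g.
Proof.
have sd := unit_aut_semidirect w_basis; split=> // g.
have det_conj (h x : 'M[R]_n) : h \in unitmx -> \det (h *m x *m invmx h) = \det x.
  move=> hU; rewrite !det_mulmx mulrAC -det_mulmx mulmxV // det1 mul1r //.
have conjK (h x : 'M[R]_n) : h \in unitmx -> invmx h *m (h *m x *m invmx h) *m h = x.
  by move=> hU; rewrite !mulmxA mulVmx // mul1mx -mulmxA mulVmx // mulmx1.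
split=> [[g1 norm] | [prod g1]].
  split=> //; have gU : g \in unitmx by rewrite unitmxE g1 unitr1.
  have normT' x : T' x -> T' (g *m x *m invmx g).
    by move=> T'x; apply/norm; exists x.
  have normT'V x : T' x -> T' (invmx g *m x *m invmx (invmx g)).
    by rewrite invmxK => /norm[y T'y ->]; rewrite conjK.
  pose J : {rmorphism R -> K} := iota \o @FracField.tofrac R.
  have J_inj : injective J.
    by move=> x y /fmorph_inj/eqP; rewrite tofrac_eq => /eqP.
  apply: normalizing_mulr_product => // [|a M aM].
    exact: (dense_conj_mul_matrix w_basis J_inj KS_tensor S_gen T'_dense normT').
  rewrite -{2}[g]invmxK; move: a M aM.
  exact: (dense_conj_mul_matrix w_basis J_inj KS_tensor S_gen T'_dense normT'V).
have [gU normT normTV] := semidirect_product_normalizes sd prod.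
split=> // y; split=> [[Ty y1] | [x [Tx x1] ->]]; last first.
  by split; [exact: normT | rewrite /special_linear det_conj].
exists (invmx g *m y *m g); last by rewrite !mulmxA mulmxV // mul1mx mulmxK.
split; first exact: normTV.
by have := det_conj (invmx g) y; rewrite invmxK unitmx_inv /special_linear => ->.
Qed.
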